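(* Let $X$ be a nonempty weakly convex compact metric space and let $c_X$ be its generalized Chebyshev center. For every isometry $\Phi$ of $X$ onto $X$, $\Phi(c_X)=c_X$.
   Context: A metric space $(X,d)$ is weakly convex if for any two points $x,y\in X$ there is a point $z\in X$ such that for each $w\in X$: (C1) $d(z,w)\le\max(d(x,w),d(y,w))$; and (C2) if $d(z,w)=\max(d(x,w),d(y,w))$ then $d(x,w)=d(y,w)$. For a metric space $(X,d)$ and $x\in X$ put $r_X(x):=\sup_{y\in X}d(x,y)$, and put $r(X):=\inf_{x\in X}r_X(x)$ (with $r(\varnothing):=0$). The Chebyshev center of $X$ is the set $C(X):=\{x\in X: r_X(x)=r(X)\}$, regarded as a metric space with the restricted metric. Define $C^0(X):=X$, $C^n(X):=C(C^{n-1}(X))$ for $n>0$, and $C^{\infty}(X):=\bigcap_{n=0}^{\infty}C^n(X)$. For a nonempty weakly convex compact metric space $X$ the set $C^\infty(X)$ consists of exactly one point; this point is called the generalized Chebyshev center of $X$ and denoted $c_X$. *)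

(* Defs.v *)
From HB Require Import structures.
From mathcomp Require Import all_boot all_order all_algebra.
From mathcomp Require Import all_classical all_reals all_analysis.

Set Implicit Arguments.
Unset Strict Implicit.
Unset Printing Implicit Defensive.

Import Order.TTheory GRing.Theory Num.Theory.

Local Open Scope classical_set_scope.
Local Open Scope ring_scope.

Definition weakly_convex (R : realType) (X : metricType R) : Prop :=
  forall x y : X, exists z : X, forall w : X,
    mdist z w <= Num.max (mdist x w) (mdist y w) /\
    (mdist z w = Num.max (mdist x w) (mdist y w) -> mdist x w = mdist y w).

(* The subspaces C^n(X), with the restricted metric, are encoded as sets of
   points of X. Radii are extended reals, since the supremum defining
   radius_at is +oo when A is unbounded. *)
Definition radius_at (R : realType) (X : metricType R) (A : set X) (x : X) :
    \bar R :=
  ereal_sup [set (mdist x y)%:E | y in A].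

(* ereal_inf set0 = +oo, so the convention r(set0) = 0 is a separate case. *)
Definition radius (R : realType) (X : metricType R) (A : set X) : \bar R :=
  if A == set0 then 0%E else ereal_inf [set radius_at A x | x in A].

Definition chebyshev_center (R : realType) (X : metricType R) (A : set X) :
    set X :=
  [set x | A x /\ radius_at A x = radius A].

Definition iterated_center (R : realType) (X : metricType R) (n : nat) :
    set X :=
  iter n (@chebyshev_center R X) [set: X].
Arguments iterated_center {R} X n.

Definition limit_center (R : realType) (X : metricType R) : set X :=
  \bigcap_(n in [set: nat]) iterated_center X n.
Arguments limit_center {R} X.

(* c_X as a definite description: the element of limit_center X, which is a
   singleton when X is nonempty, compact and weakly convex. The default value
   of xget, a point given by the nonemptiness of X, is taken only if
   limit_center X is empty. *)
Definition generalized_center (R : realType) (X : metricType R)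
    (X0 : [set: X] !=set0) : X :=
  xget (projT1 (cid X0)) (limit_center X).

Definition isometry_onto (R : realType) (X Y : metricType R) (Phi : X -> Y) :
    Prop :=
  (forall x y : X, mdist (Phi x) (Phi y) = mdist x y) /\
  (forall y : Y, exists x : X, Phi x = y).

(* Main.v *)
Require Import Defs.
From HB Require Import structures.
From mathcomp Require Import all_boot all_order all_algebra.
From mathcomp Require Import all_classical all_reals all_analysis.

(* Writing K for limit_center X, every step is the same compactness argument:
   a downward directed family of nonempty closed sets has a common point. It
   gives a farthest point of a closed set, a point of the Chebyshev center, and
   a point of K. The points of K have equal radius in each C^n(X), hence, by
   compactness again, the same radius D in K. The point z given by weak
   convexity for x, y in K stays in K, and by (C2) a point of K at distance D
   from z is at distance D from both x and y. So the sets of points of K at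
   distance D from x, for x in K, are directed; a common point w satisfies
   D = d(w, w) = 0, and K is a singleton. Finally, an isometry onto preserves
   each C^n(X), hence K. *)

Set Implicit Arguments.
Unset Strict Implicit.
Unset Printing Implicit Defensive.

Import Order.TTheory GRing.Theory Num.Theory.

Local Open Scope classical_set_scope.
Local Open Scope ring_scope.

(** The [F i] form a base of a proper filter, and a cluster point of that filter lies in every [F i]
    by closedness. *)
Lemma compact_directed_bigcap (T : topologicalType) (I : Type) (D : set I)
    (F : I -> set T) :
  compact [set: T] -> D !=set0 ->
  (forall i j, D i -> D j -> exists2 k, D k & F k `<=` F i `&` F j) ->
  (forall i, D i -> closed (F i)) -> (forall i, D i -> F i !=set0) ->
  \bigcap_(i in D) F i !=set0.
Proof.
move=> cT [i0 Di0] dirF clF F0.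
have FF : ProperFilter (filter_from D F).
  apply: filter_from_proper => //.
  by apply: filter_from_filter => //; exists i0.
have [p [_ clp]] := cT _ FF filterT.
exists p => i Di; apply: (clF i Di) => B nB.
by apply: clp => //; exists i.
Qed.

Section chebyshev.
Context {R : realType} {X : metricType R}.
Implicit Types (A : set X) (x y z w : X).

Lemma closed_mdist_le x (r : R) : closed [set y | mdist x y <= r].
Proof.
move=> p clp /=; rewrite leNgt; apply/negP => rp.
(* By the triangle inequality the ball of this radius about [p] misses the set. *)
have e0 : 0 < mdist x p - r by rewrite subr_gt0.
have [q [/= xq]] := clp _ (nbhsx_ballx p _ e0).
rewrite ballEmdist /= metric_sym ltrBrDr => pq.
have := metric_triangle x q p; rewrite leNgt => /negP; apply.
by rewrite (le_lt_trans _ pq)// addrC lerD2l.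
Qed.

Lemma closed_mdist_ge x (r : R) : closed [set y | r <= mdist x y].
Proof.
move=> p clp /=; rewrite leNgt; apply/negP => rp.
have e0 : 0 < r - mdist x p by rewrite subr_gt0.
have [q [/= xq]] := clp _ (nbhsx_ballx p _ e0).
rewrite ballEmdist /= ltrBrDr => pq.
have := metric_triangle x p q; rewrite leNgt => /negP; apply.
by rewrite (lt_le_trans _ xq)// addrC.
Qed.

Lemma radius_at_le A x (r : \bar R) :
  (radius_at A x <= r)%E <-> (forall y, A y -> ((mdist x y)%:E <= r)%E).
Proof.
split=> [rA y Ay|rA]; last by apply: ge_ereal_sup => _ [y Ay <-]; exact: rA.
by apply: le_trans rA; apply: ereal_sup_ubound; exists y.
Qed.

Lemma radius_at_ge A x y : A y -> ((mdist x y)%:E <= radius_at A x)%E.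
Proof. by apply: (radius_at_le A x _).1. Qed.

Lemma closed_radius_at_le A (r : \bar R) :
  closed [set x | (radius_at A x <= r)%E].
Proof.
(* A sublevel set of the radius is an intersection of closed balls centered at the points of [A]. *)
have -> : [set x | (radius_at A x <= r)%E] =
    \bigcap_(y in A) [set x | ((mdist y x)%:E <= r)%E].
  apply/seteqP; split => x /=.
    by move=> /radius_at_le rA y Ay /=; rewrite metric_sym; exact: rA.
  by move=> rA; apply/radius_at_le => y Ay; rewrite metric_sym; exact: rA.
apply: closed_bigI => y _; case: r => [r| |].
- by under eq_set do rewrite lee_fin; exact: closed_mdist_le.
- rewrite (_ : mkset _ = setT); first exact: closedT.
  by apply/seteqP; split => // x _ /=; rewrite leey.
- rewrite (_ : mkset _ = set0); first exact: closed0.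
  by apply/seteqP; split => // x /=; rewrite leeNy_eq.
Qed.

Lemma radius_le_radius_at A x : A x -> (Defs.radius A <= radius_at A x)%E.
Proof.
move=> Ax; rewrite /Defs.radius; case: eqP => [A0|_]; first by rewrite A0 in Ax.
by apply: ereal_inf_lbound; exists x.
Qed.

(** The radius of [A] is a lower bound on [A], so equality weakens to an inequality, which is a
    closed condition. *)
Lemma chebyshev_centerE A :
  chebyshev_center A = A `&` [set x | (radius_at A x <= Defs.radius A)%E].
Proof.
apply/seteqP; split => x [Ax rx]; split => //=; first by rewrite rx.
by apply/eqP; rewrite eq_le rx radius_le_radius_at.
Qed.

Lemma closed_chebyshev_center A : closed A -> closed (chebyshev_center A).
Proof.
by move=> cA; rewrite chebyshev_centerE; apply: closedI => //;
  exact: closed_radius_at_le.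
Qed.

Lemma closed_iterated_center n : closed (iterated_center X n).
Proof.
by elim: n => [|n IHn]; [exact: closedT | exact: closed_chebyshev_center].
Qed.

Lemma iterated_center_subset m n :
  (m <= n)%N -> iterated_center X n `<=` iterated_center X m.
Proof.
elim: n => [|n IHn]; first by rewrite leqn0 => /eqP ->.
rewrite leq_eqVlt => /orP[/eqP -> //|mn] x [xn _]; exact: IHn.
Qed.

Lemma closed_limit_center : closed (limit_center X).
Proof. by apply: closed_bigI => n _; exact: closed_iterated_center. Qed.

(** Induction on [n]: once [Phi] maps C^n(X) onto itself, it preserves radii in C^n(X), hence the
    next center. Surjectivity supplies the preimages. *)
Lemma isometry_iterated_center (Phi : X -> X) n x : isometry_onto Phi ->
  iterated_center X n (Phi x) <-> iterated_center X n x.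
Proof.
move=> [Phid Phis]; elim: n x => [//|n IHn] x /=.
have rP y : radius_at (iterated_center X n) (Phi y) =
            radius_at (iterated_center X n) y.
  congr ereal_sup; apply/seteqP; split => _ [w Aw <-].
    have [v vw] := Phis w; exists v; first by apply/IHn; rewrite vw.
    by rewrite -vw Phid.
  by exists (Phi w); [exact/IHn | rewrite Phid].
by split => -[/IHn Ax rx]; split => //; [rewrite -rP | rewrite rP].
Qed.

Lemma limit_center_radius_at n x : limit_center X x ->
  radius_at (iterated_center X n) x = Defs.radius (iterated_center X n).
Proof. by move=> Kx; case: (Kx n.+1 I). Qed.

(** By (C1) the radius of [z] in C^n(X) is at most the larger of those of [x] and [y], which are
    both minimal; so [z] passes from each center to the next. *)
Lemma weakly_convex_limit_center x y :
  weakly_convex X -> limit_center X x -> limit_center X y ->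
  exists2 z, limit_center X z & forall w,
    mdist z w <= Num.max (mdist x w) (mdist y w) /\
    (mdist z w = Num.max (mdist x w) (mdist y w) -> mdist x w = mdist y w).
Proof.
move=> cX Kx Ky; have [z zP] := cX x y; exists z => // n _.
elim: n => [//|n IHn]; change (chebyshev_center (iterated_center X n) z).
rewrite chebyshev_centerE; split => //=; apply/radius_at_le => w Aw.
have [zw _] := zP w; move: zw; rewrite -lee_fin => /le_trans; apply.
case: (leP (mdist x w)) => _.
  by rewrite -(limit_center_radius_at n Ky); exact: radius_at_ge.
by rewrite -(limit_center_radius_at n Kx); exact: radius_at_ge.
Qed.

Hypothesis Xcompact : compact [set: X].

Lemma farthest_point A x : closed A -> A !=set0 ->
  exists2 w, A w & forall v, A v -> mdist x v <= mdist x w.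
Proof.
move=> cA A0.
(* These sets form a chain: the farther [v] is from [x], the smaller its set. *)
have [| | |w Fw] := compact_directed_bigcap
  (F := fun v => A `&` [set w | mdist x v <= mdist x w]) Xcompact A0.
- move=> u v Au Av; have [uv|vu] := leP (mdist x u) (mdist x v).
    by exists v => // w [Aw vw]; split; split => //; exact: le_trans vw.
  by exists u => // w [Aw uw]; split; split => //; exact: le_trans (ltW vu) _.
- by move=> v _; apply: closedI => //; exact: closed_mdist_ge.
- by move=> v Av; exists v; split => /=.
have [v Av] := A0; exists w => [|u Au]; first exact: (Fw v Av).1.
exact: (Fw u Au).2.
Qed.

Lemma chebyshev_center_neq0 A :
  closed A -> A !=set0 -> chebyshev_center A !=set0.
Proof.
move=> cA A0.
have [| | |w Fw] := compact_directed_bigcap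
  (F := fun v => A `&` [set w | (radius_at A w <= radius_at A v)%E])
  Xcompact A0.
- move=> u v Au Av; have [uv|vu] := leP (radius_at A u) (radius_at A v).
    by exists u => // w [Aw uw]; split; split => //; exact: le_trans uv.
  by exists v => // w [Aw vw]; split; split => //; exact: le_trans (ltW vu).
- by move=> v _; apply: closedI => //; exact: closed_radius_at_le.
- by move=> v Av; exists v; split => /=.
have [v Av] := A0; exists w; rewrite chebyshev_centerE; split => /=.
  exact: (Fw v Av).1.
rewrite /Defs.radius; case: eqP => [E|_]; first by rewrite E in Av.
by apply: le_ereal_inf_tmp => _ [u Au <-]; exact: (Fw u Au).2.
Qed.

Hypothesis X0 : [set: X] !=set0.

Lemma limit_center_neq0 : limit_center X !=set0.
Proof.
apply: compact_directed_bigcap => //.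
- move=> m n _ _; exists (maxn m n) => // x xmn.
  by split; apply: iterated_center_subset xmn; rewrite ?leq_maxl ?leq_maxr.
- by move=> n _; exact: closed_iterated_center.
- move=> n _; elim: n => [//|n IHn]; apply: chebyshev_center_neq0 => //.
  exact: closed_iterated_center.
Qed.

(** The radius of C^n(X) at [x] equals that at [x'], so it is at least [mdist x' w], and it is
    attained. The points of C^n(X) this far from [x] form nested closed sets, whose common point
    lies in K. *)
Lemma limit_center_equidistant x x' w :
  limit_center X x -> limit_center X x' -> limit_center X w ->
  exists2 v, limit_center X v & mdist x' w <= mdist x v.
Proof.
move=> Kx Kx' Kw.
have [| | | |v Fv] := compact_directed_bigcap (D := [set: nat])
  (F := fun n => iterated_center X n `&` [set v | mdist x' w <= mdist x v])
  Xcompact.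
- by exists 0%N.
- move=> m n _ _; exists (maxn m n) => // v [vmn wv].
  by split; split => //;
    apply: iterated_center_subset vmn; rewrite ?leq_maxl ?leq_maxr.
- move=> n _; apply: closedI; first exact: closed_iterated_center.
  exact: closed_mdist_ge.
- move=> n _; have [||v Av vP] := @farthest_point (iterated_center X n) x.
  + exact: closed_iterated_center.
  + by exists w; exact: Kw.
  exists v; split => //=; rewrite -lee_fin.
  apply: (@le_trans _ _ (radius_at (iterated_center X n) x)).
    rewrite limit_center_radius_at// -(limit_center_radius_at n Kx').
    by apply: radius_at_ge; exact: Kw.
  by apply/radius_at_le => u Au; rewrite lee_fin; exact: vP.
by exists v => [n _|]; [exact: (Fv n I).1 | exact: (Fv 0%N I).2].
Qed.

Lemma limit_center_unique x y :
  weakly_convex X -> limit_center X x -> limit_center X y -> x = y.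
Proof.
move=> cX Kx Ky.
have [w0 Kw0 w0P] := farthest_point x closed_limit_center limit_center_neq0.
pose D := mdist x w0.
have leD u v : limit_center X u -> limit_center X v -> mdist u v <= D.
  move=> Ku Kv; have [t Kt ut] := limit_center_equidistant Kx Ku Kv.
  exact: le_trans ut (w0P t Kt).
have [| | |w Fw] := compact_directed_bigcap
  (F := fun u => limit_center X `&` [set v | D <= mdist u v])
  Xcompact limit_center_neq0.
- move=> u v Ku Kv; have [z Kz zP] := weakly_convex_limit_center cX Ku Kv.
  exists z => // t [Kt /= Dz]; have [zt1 zt2] := zP t.
  (* No two points of K are farther apart than [D], so [D <= mdist z t] forces equality in (C1), and
     (C2) applies. *)
  have maxD : Num.max (mdist u t) (mdist v t) <= D by rewrite ge_max !leD.
  have zD : mdist z t = Num.max (mdist u t) (mdist v t).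
    by apply/eqP; rewrite eq_le zt1 (le_trans maxD).
  have uv := zt2 zD; move: zD; rewrite -uv maxxx => zD.
  by split; split => //=; rewrite -?uv -zD.
- move=> u _; apply: closedI; first exact: closed_limit_center.
  exact: closed_mdist_ge.
- by move=> u Ku; have [t Kt ut] := limit_center_equidistant Ku Kx Kw0; exists t.
(* The common point [w] lies in K, so it is itself an index of the family. *)
have [Kw _] := Fw x Kx; have [_ /=] := Fw w Kw.
rewrite mdistxx => D0; apply: mdist_positivity.
by apply/eqP; rewrite eq_le mdist_ge0 (le_trans (leD _ _ Kx Ky)).
Qed.

End chebyshev.

Theorem corollary3p7 (R : realType) (X : metricType R)
    (X0 : [set: X] !=set0) (Xconv : weakly_convex X)
    (Xcompact : compact [set: X]) (Phi : X -> X) (PhiI : isometry_onto Phi) :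
  Phi (generalized_center X0) = generalized_center X0.
Proof.
(* Since K is nonempty, [xget] returns a point of K and not its default. *)
have Kc : limit_center X (generalized_center X0).
  by have [x Kx] := limit_center_neq0 Xcompact X0; exact: xgetI Kx.
apply: (limit_center_unique Xcompact X0 Xconv) => // n _.
exact/(isometry_iterated_center n _ PhiI)/Kc.
Qed.
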